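(* For all $n\geq 1$, $$B_{n}^{neobc}=\frac{21B_{2n-1}-3B_{2n-2}+3}{4},\quad C_{n}^{neobc}=15B_{2n-1}-3B_{2n-2},$$ $$R_{n}^{neobc}=\frac{9B_{2n-1}-3B_{2n-2}-5}{4},\quad CR_{n}^{neobc}=3B_{2n-1}.$$
   Context: Balancing numbers: $B_0=0$, $B_1=1$, $B_k=6B_{k-1}-B_{k-2}$ for $k\geq2$. A positive integer $m$ is a neo balcobalancing number if there is a positive integer $r$ (its neo balcobalancer) such that $(1+2+\cdots+(m-1))+(1+2+\cdots+m)=2[(m-1)+m+(m+1)+(m+2)+\cdots+(m+r)]$; then $r=\frac{-2m-1+\sqrt{8m^2-12m+9}}{2}$ (equivalently, $m$ is a neo balcobalancing number iff $8m^2-12m+9$ is a perfect square). $B_n^{neobc}$ denotes the $n$-th neo balcobalancing number in increasing order ($n\ge1$), $R_n^{neobc}$ its neo balcobalancer, $C_n^{neobc}=\sqrt{8(B_n^{neobc})^2-12B_n^{neobc}+9}$ (neo Lucas-balcobalancing number) and $CR_n^{neobc}=\sqrt{2(R_n^{neobc})^2+5R_n^{neobc}+2}$ (neo Lucas-balcobalancer). *)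

(* Defs.v *)
From HB Require Import structures.
From mathcomp Require Export all_boot all_order all_algebra.
From mathcomp Require Export boolp classical_sets reals.

Set Implicit Arguments.
Unset Strict Implicit.
Unset Printing Implicit Defensive.

Import Order.TTheory GRing.Theory Num.Theory.

Local Open Scope classical_set_scope.
Local Open Scope ring_scope.

Fixpoint balancing (k : nat) : int :=
  match k with
  | 0 => 0
  | k1.+1 => match k1 with
             | 0 => 1
             | k2.+1 => 6 * balancing k1 - balancing k2
             end
  end.

Definition is_neobc_balancer (m r : nat) : Prop :=
  (0 < r)%N /\
  (\sum_(1 <= i < m) i + \sum_(1 <= i < m.+1) i
   = 2 * \sum_(m.-1 <= i < (m + r).+1) i)%N.

Definition is_neobc (m : nat) : Prop :=
  (0 < m)%N /\ exists r : nat, is_neobc_balancer m r.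

(* [m] is the [n]-th element in increasing order: it is an element, and exactly
   [n] elements are at most [m]. *)
Definition is_nth_neobc (n m : nat) : Prop :=
  is_neobc m /\ count (fun k => `[< is_neobc k >]) (iota 1 m) = n.

(* The default value 0 is neither a neo balcobalancing number nor a neo
   balcobalancer, so it cannot be mistaken for a genuine value. *)
Definition neobc (n : nat) : nat := xget 0%N [set m | is_nth_neobc n m].

Definition neobc_balancer (n : nat) : nat :=
  xget 0%N [set r | is_neobc_balancer (neobc n) r].

Definition neobc_lucas (R : realType) (n : nat) : R :=
  Num.sqrt (8 * (neobc n)%:R ^+ 2 - 12 * (neobc n)%:R + 9).

Definition neobc_lucas_balancer (R : realType) (n : nat) : R :=
  Num.sqrt (2 * (neobc_balancer n)%:R ^+ 2 + 5 * (neobc_balancer n)%:R + 2).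

(* Main.v *)
(** Summing the arithmetic progressions, [(m, r)] is a solution exactly when
    [m^2 + 2 = r^2 + r + 2 m r + 4 m].  With [x = 4 m - 3] and
    [C = 2 r + 2 m + 1] this is the Pell-type equation [x^2 - 2 C^2 = -9], on
    which multiplication of [x + C sqrt 2] by [17 + 12 sqrt 2] acts.  In the
    coordinates [(m, r)] this is the affine map
    [(m, r) |-> (29 m + 12 r - 6, 12 m + 5 r - 4)], and its inverse strictly
    decreases [m] and keeps positive solutions positive until it reaches
    [(6, 1)].  So the positive solutions are the orbit of [(6, 1)], listed with
    [m] increasing, and the orbit is expressed through balancing numbers by
    induction.  Both square roots are then integers:
    [8 m^2 - 12 m + 9 = (2 r + 2 m + 1)^2] and
    [2 r^2 + 5 r + 2 = (m - r - 2)^2]. *)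

Require Import Defs.
From mathcomp Require Import all_boot all_order all_algebra.
From mathcomp Require Import boolp classical_sets reals.
From mathcomp Require Import zify lra.

Import Order.TTheory GRing.Theory Num.Theory.
Local Open Scope ring_scope.

(** The elements of [P] in [[1, f i]] are exactly [f 0, ..., f i], so the filtered range is a
    permutation of the image of [iota 0 i.+1] under [f]. *)
Lemma count_enumeration (P : nat -> Prop) (f : nat -> nat) :
  (forall i, (0 < f i)%N) -> {mono f : i j / (i <= j)%N} ->
  (forall m, P m <-> exists i, m = f i) ->
  forall i, count (fun k => `[< P k >]) (iota 1 (f i)) = i.+1.
Proof.
move=> f_gt0 f_mono Pf i.
have f_inj : injective f := incn_inj f_mono.
rewrite -size_filter -[RHS](size_iota 0) -[RHS](size_map f).
apply/perm_size/uniq_perm.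
- exact/filter_uniq/iota_uniq.
- by rewrite map_inj_uniq // iota_uniq.
move=> k; rewrite mem_filter mem_iota; apply/andP/mapP.
- case=> /asboolP/Pf[j ->] /andP[_ le_ji]; exists j => //.
  by rewrite mem_iota /= !add0n ltnS -f_mono -ltnS.
- case=> j; rewrite mem_iota /= !add0n ltnS => le_ji ->.
  split; first by apply/asboolP/Pf; exists j.
  by rewrite f_gt0 add1n ltnS f_mono.
Qed.

Lemma sum_nat_double a b : (a <= b)%N ->
  (2 * \sum_(a <= i < b) i + a * a.-1 = b * b.-1)%N.
Proof.
elim: b => [|b IHb]; first by rewrite leqn0 => /eqP->; rewrite big_geq.
rewrite leq_eqVlt => /orP[/eqP->|]; first by rewrite big_geq.
rewrite ltnS => le_ab; rewrite big_nat_recr //=.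
have := IHb le_ab; case: (b) => [|c] /=; nia.
Qed.

Lemma neobc_balancerE m r : (0 < m)%N ->
  is_neobc_balancer m r <->
  (0 < r)%N /\ (m * m + 2 = r * r + r + 2 * m * r + 4 * m)%N.
Proof.
case: m => // m _; rewrite /is_neobc_balancer.
have h1 := @sum_nat_double 1 m.+1 isT.
have h2 := @sum_nat_double 1 m.+2 isT.
have h3 := @sum_nat_double m (m.+1 + r).+1 ltac:(lia).
move: h1 h2 h3 => /=.
set s1 := bigop _ _ _; set s2 := bigop _ _ _; set s3 := bigop _ _ _.
move=> h1 h2 h3.
(* Here [m] is one less than the original, so [h3] contains [m.-1]; adding [m] to both sides removes
   this truncated predecessor. *)
have e3 : (2 * s3 + m * m = (m + r + 2) * (m + r + 1) + m)%N.
  by move: h3; case: (m) => [|k] /= h3; nia.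
by split=> -[r_gt0 e]; split=> //; nia.
Qed.

Definition neobc_next (p : nat * nat) : nat * nat :=
  ((29 * p.1 + 12 * p.2 - 6)%N, (12 * p.1 + 5 * p.2 - 4)%N).

Definition neobc_orbit (i : nat) : nat * nat := iter i neobc_next (6, 1)%N.

Lemma neobc_orbit_solution i (p := neobc_orbit i) :
  [/\ (0 < p.1)%N, (0 < p.2)%N &
     (p.1 * p.1 + 2 = p.2 * p.2 + p.2 + 2 * p.1 * p.2 + 4 * p.1)%N].
Proof.
rewrite {}/p; elim: i => [|i] //=; rewrite -/(neobc_orbit i).
case: (neobc_orbit i) => m r /= [m_gt0 r_gt0 e]; split; [lia..|].
(* Naming the differences shows that the truncated subtractions of [neobc_next] are exact. *)
have [a ea] : exists a, (29 * m + 12 * r = a + 6)%N.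
  by exists (29 * m + 12 * r - 6)%N; lia.
have [b eb] : exists b, (12 * m + 5 * r = b + 4)%N.
  by exists (12 * m + 5 * r - 4)%N; lia.
rewrite ea eb !addnK; nia.
Qed.

(* In the descent step, [r' > 0] does not follow from size estimates alone:
   one has [2 m' + r' + 1 > 0] and [r' (2 m' + r' + 1) = m'^2 - 4 m' + 2], which
   settles [m' >= 4], and [m' = 1, 2, 3] are excluded by integrality. *)
Lemma neobc_descent (m r : nat) : (6 < m)%N -> (0 < r)%N ->
  (m * m + 2 = r * r + r + 2 * m * r + 4 * m)%N ->
  exists m' r' : nat, [/\ (0 < m')%N, (0 < r')%N, (m' < m)%N,
    (m' * m' + 2 = r' * r' + r' + 2 * m' * r' + 4 * m')%N &
    (m, r) = neobc_next (m', r')].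
Proof.
move=> m_gt6 r_gt0 e.
(* Inverting [neobc_next] (determinant 1) gives [m' = 5 m - 12 r - 18] and [r' = 29 r - 12 m + 44],
   called [a] and [b] below. The three bounds say [m' > 0], [m' < m] and [m' + r' >= 0]. *)
have m'_gt0 : (12 * r + 18 < 5 * m)%N.
  rewrite ltnNge; apply/negP => h.
  have : ((5 * m - 18) * (5 * m - 18) <= (12 * r) * (12 * r))%N.
    by apply: leq_mul; lia.
  nia.
have m'_lt : (4 * m < 12 * r + 18)%N by nia.
have C'_gt0 : (7 * m < 17 * r + 27)%N by nia.
pose a : int := 5 * m%:Z - 12 * r%:Z - 18.
pose b : int := 29 * r%:Z - 12 * m%:Z + 44.
have eab : a * a + 2 = b * b + b + 2 * a * b + 4 * a by rewrite /a /b; nia.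
have a_gt0 : 0 < a by rewrite /a; lia.
have ab_gt0 : 0 <= a + b by rewrite /a /b; lia.
have b_gt0 : 0 < b.
  case: (ltP 0 b) => // b_le0.
  have [a1|[a2|[a3|a_ge4]]] : a = 1 \/ a = 2 \/ a = 3 \/ 4 <= a by lia.
  - nia.
  - nia.
  - have : b = 0 \/ b = -1 \/ b = -2 \/ b = -3 by lia.
    nia.
  - nia.
exists `|a|%N, `|b|%N; split.
- lia.
- lia.
- rewrite /a; lia.
- nia.
- by congr (_, _); rewrite /= /a /b in a_gt0 b_gt0 *; lia.
Qed.

Lemma neobc_solution_orbit (m r : nat) : (0 < m)%N -> (0 < r)%N ->
  (m * m + 2 = r * r + r + 2 * m * r + 4 * m)%N ->
  exists i, (m, r) = neobc_orbit i.
Proof.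
elim/ltn_ind: m r => m IHm r m_gt0 r_gt0 e.
have [m_gt6|m_le6] := ltnP 6 m.
  have [m' [r' [m'_gt0 r'_gt0 lt_m'm e' ->]]] := neobc_descent m r m_gt6 r_gt0 e.
  by have [i ->] := IHm m' lt_m'm r' m'_gt0 r'_gt0 e'; exists i.+1.
exists 0%N => /=.
(* In [m^2 - 4 m + 2 = r (r + 1 + 2 m)] the left side is negative for [m <= 3] and equals 2, 7, 14
   for [m] = 4, 5, 6, while the right side is at least 10, 12, 14. *)
have m6 : m = 6%N.
  have [le_m3|lt_3m] := leqP m 3; first by nia.
  have [em|[em|//]] : m = 4%N \/ m = 5%N \/ m = 6%N by clear -m_le6 lt_3m; lia.
    by subst m; clear -r_gt0 e; nia.
  by subst m; clear -r_gt0 e; nia.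
by subst m; congr (_, _); nia.
Qed.

Lemma neobc_orbit_mono : {mono (fun i => (neobc_orbit i).1) : i j / (i <= j)%N}.
Proof.
apply: leq_mono; apply: homo_ltn; first exact: ltn_trans.
move=> i; have [] := neobc_orbit_solution i.
by rewrite /= -/(neobc_orbit i) => ? ? _; lia.
Qed.

Lemma is_neobc_balancer_orbit m r :
  (0 < m)%N /\ is_neobc_balancer m r <-> exists i, (m, r) = neobc_orbit i.
Proof.
split=> [[m_gt0 /neobc_balancerE-/(_ m_gt0)[r_gt0 e]]|[i ei]].
  exact: neobc_solution_orbit.
have := neobc_orbit_solution i; rewrite -ei /= => -[m_gt0 r_gt0 e].
by split=> //; apply/neobc_balancerE.
Qed.

Lemma is_neobc_orbit m : is_neobc m <-> exists i, m = (neobc_orbit i).1.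
Proof.
split=> [[m_gt0 [r mr]]|[i ->]].
  have /is_neobc_balancer_orbit[i ei] := conj m_gt0 mr.
  by exists i; rewrite -ei.
have [] := (is_neobc_balancer_orbit (neobc_orbit i).1 (neobc_orbit i).2).2.
  by exists i; rewrite -surjective_pairing.
by move=> m_gt0 mr; split=> //; exists (neobc_orbit i).2.
Qed.

Lemma neobc_orbitE i : neobc i.+1 = (neobc_orbit i).1.
Proof.
have cnt := count_enumeration is_neobc (fun i => (neobc_orbit i).1)
  (fun i => let: And3 h _ _ := neobc_orbit_solution i in h)
  neobc_orbit_mono is_neobc_orbit.
apply: xget_unique => /=.
  by split; [apply/is_neobc_orbit; exists i | exact: cnt].
by move=> m [/is_neobc_orbit[j ->]]; rewrite cnt => -[->].
Qed.

Lemma neobc_balancer_orbitE i : neobc_balancer i.+1 = (neobc_orbit i).2.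
Proof.
rewrite /neobc_balancer neobc_orbitE.
have [m_gt0 mr] : (0 < (neobc_orbit i).1)%N /\
    is_neobc_balancer (neobc_orbit i).1 (neobc_orbit i).2.
  by apply/is_neobc_balancer_orbit; exists i; rewrite -surjective_pairing.
apply: xget_unique => //= r mr'.
have /is_neobc_balancer_orbit[j ej] := conj m_gt0 mr'.
(* The first coordinate determines the orbit index, hence the balancer. *)
have /(incn_inj neobc_orbit_mono) -> : (neobc_orbit i).1 = (neobc_orbit j).1.
  by rewrite -ej.
by rewrite -ej.
Qed.

Lemma balancingSS k : balancing k.+2 = 6 * balancing k.+1 - balancing k.
Proof. by []. Qed.

(** One orbit step corresponds to two steps of the balancing recurrence. *)
Lemma neobc_orbit_balancing i
    (b := balancing i.*2.+1) (a := balancing i.*2) :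
  4 * (neobc_orbit i).1%:Z = 21 * b - 3 * a + 3 /\
  4 * (neobc_orbit i).2%:Z = 9 * b - 3 * a - 5.
Proof.
rewrite {}/a {}/b; elim: i => [//|i [e1 e2]].
have [m_gt0 r_gt0 _] := neobc_orbit_solution i.
rewrite doubleS !balancingSS.
move: (balancing _) (balancing _) e1 e2 => a b e1 e2 /=.
by rewrite -/(neobc_orbit i); lia.
Qed.

Theorem theorem2p2 (R : realType) (n : nat) (hn : (1 <= n)%N) :
  [/\ (neobc n)%:R =
        (21 * (balancing (2 * n - 1))%:~R - 3 * (balancing (2 * n - 2))%:~R + 3)
          / 4 :> R,
      neobc_lucas R n =
        15 * (balancing (2 * n - 1))%:~R - 3 * (balancing (2 * n - 2))%:~R,
      (neobc_balancer n)%:R =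
        (9 * (balancing (2 * n - 1))%:~R - 3 * (balancing (2 * n - 2))%:~R - 5)
          / 4 :> R
    & neobc_lucas_balancer R n = 3 * (balancing (2 * n - 1))%:~R].
Proof.
case: n hn => // i _.
have -> : (2 * i.+1 - 1 = i.*2.+1)%N by lia.
have -> : (2 * i.+1 - 2 = i.*2)%N by lia.
rewrite /neobc_lucas /neobc_lucas_balancer neobc_orbitE neobc_balancer_orbitE.
have [] := neobc_orbit_balancing i; have [] := neobc_orbit_solution i.
move: (balancing _) (balancing _) => a b.
case: (neobc_orbit i) => m r /= m_gt0 r_gt0 e em er.
(* This fixes the sign of the square root of [(m - r - 2)^2]. *)
have lt_rm : (r + 2 <= m)%N by clear -m_gt0 r_gt0 e; nia.
have eR : m%:R * m%:R + 2 = r%:R * r%:R + r%:R + 2 * m%:R * r%:R + 4 * m%:R :> R.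
  by have := congr1 (GRing.natmul (1 : R)) e; lra.
have emR : 4 * m%:R = 21 * b%:~R - 3 * a%:~R + 3 :> R.
  by have := congr1 (intmul (1 : R)) em; lra.
have erR : 4 * r%:R = 9 * b%:~R - 3 * a%:~R - 5 :> R.
  by have := congr1 (intmul (1 : R)) er; lra.
have bR_ge0 : 0 <= m%:R - r%:R - 2 :> R.
  by move: lt_rm; rewrite -(ler_nat R) natrD; lra.
split; [lra| |lra|].
- have -> : 8 * m%:R ^+ 2 - 12 * m%:R + 9 = (2 * r%:R + 2 * m%:R + 1) ^+ 2 :> R.
    by rewrite !expr2; lra.
  rewrite sqrtr_sqr ger0_norm; first by lra.
  by rewrite !addr_ge0 ?mulr_ge0.
- have -> : 2 * r%:R ^+ 2 + 5 * r%:R + 2 = (m%:R - r%:R - 2) ^+ 2 :> R.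
    by rewrite !expr2; lra.
  by rewrite sqrtr_sqr ger0_norm //; lra.
Qed.
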